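(* Let $D=DS(X,\Gamma_0)\subset\mathcal{X}_3$ be an exact (partial) Dirichlet-Selberg domain centered at a point $X\in\mathcal{X}_3$, defined with respect to a finite set $\Gamma_0\subset SL(3,\mathbb{R})$, and satisfying the tiling condition. If, in addition, $D$ has finite volume, then the quotient $M=D/\!\sim$ of $D$ under its intrinsic facet pairing is complete.
   Context: $\mathcal{X}_n=\{X\in \mathrm{Sym}_n(\mathbb{R}) : \det X=1,\ X>0\}$ with Riemannian metric $\langle A,B\rangle_X=\mathrm{tr}(X^{-1}AX^{-1}B)$ (a model of $SL(n,\mathbb{R})/SO(n)$); it is identified with the projective model $\{[X]\in\mathbf{P}(\mathrm{Sym}_n(\mathbb{R})): X>0\}$. $SL(n,\mathbb{R})$ acts isometrically by $g.X=g^{\mathsf T}Xg$. The Satake compactification is $\overline{\mathcal{X}_n}=\{[X]\in\mathbf{P}(\mathrm{Sym}_n(\mathbb{R})): X\ge 0\}$. Selberg invariant: $\mathfrak{s}(X,Y)=\mathrm{tr}(X^{-1}Y)$. For $X\in\mathcal{X}_n$ and $\Gamma_0\subset SL(n,\mathbb{R})$, the Dirichlet-Selberg domain is $DS(X,\Gamma_0)=\{Y\in\mathcal{X}_n : \mathfrak{s}(g.X,Y)\ge \mathfrak{s}(X,Y)\ \forall g\in\Gamma_0\}$ (''partial'' indicates that $\Gamma_0$ is only a finite subset, not a group). Bisector: $\mathrm{Bis}(X,g.X)=\{Y\in\mathcal{X}_n:\mathfrak{s}(X,Y)=\mathfrak{s}(g.X,Y)\}$. Hyperplanes of $\mathcal{X}_n$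 are nonempty intersections of $\mathcal{X}_n$ with linear hyperplanes of $\mathrm{Sym}_n(\mathbb{R})$; convex polytopes (finite intersections of half-spaces bounded by hyperplanes), their faces and facets (codimension-one faces) are defined as in hyperbolic geometry. $D$ is a convex polytope. Exact, with intrinsic facet pairing: each facet $F$ of $D$ lies in a bisector $\mathrm{Bis}(X,g.X)$ for an element $g=g_F\in\Gamma_0$ with $g_F^{-1}\in\Gamma_0$, such that $F=D\cap g_F.D$ and $F'=g_F^{-1}.F$ is also a facet of $D$, contained in $\mathrm{Bis}(X,g_F^{-1}.X)$, with $g_{F'}=g_F^{-1}$. The set $\{g_F\}$ is the intrinsic facet pairing. The equivalence relation $\sim$ on $D$ is generated by $Y\sim g_F^{-1}.Y$ for $Y\in F$, $F$ a facet of $D$. Tiling condition: $M=D/\!\sim$, with the path metric induced from $\mathcal{X}_n$, has the structure of an $\mathcal{X}_n$-manifold or orbifold. $M$ is complete if it is complete for this metric. Finite volume: $D$ has finite volume if there is a projective convex polytope $\mathbf{D}\subset\mathbf{P}(\mathrm{Sym}_n(\mathbb{R}))$ with $\mathbf{D}\subset\overline{\mathcal{X}_n}$ and $D=\mathbf{D}\cap\mathcal{X}_n$. *)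

(* Defs.v *)
From Stdlib Require Export Relation_Operators.
From HB Require Export structures.
From mathcomp Require Export all_boot all_order all_algebra.
From mathcomp Require Export all_classical all_reals all_analysis.

Set Implicit Arguments.
Unset Strict Implicit.
Unset Printing Implicit Defensive.

Export Order.TTheory GRing.Theory Num.Theory.
Export numFieldNormedType.Exports.

Local Open Scope classical_set_scope.
Local Open Scope ring_scope.

Section SymmetricSpace.
Context {R : realType} {n : nat}.
Implicit Types (X Y Z A g h : 'M[R]_n) (S D F : set 'M[R]_n).

Definition Sym : set 'M[R]_n := [set A | A^T = A].

Definition pos_def X : Prop :=
  forall v : 'cV[R]_n, v != 0 -> 0 < (v^T *m X *m v) 0 0.

Definition pos_semidef X : Prop :=
  forall v : 'cV[R]_n, 0 <= (v^T *m X *m v) 0 0.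

Definition Xspace : set 'M[R]_n :=
  [set X | [/\ Sym X, \det X = 1 & pos_def X]].

Definition SL : set 'M[R]_n := [set g | \det g = 1].

(* A right action: act (g *m h) X = act h (act g X). *)
Definition act g X : 'M[R]_n := g^T *m X *m g.

Definition selberg X Y : R := \tr (invmx X *m Y).

Definition DS X (Gamma0 : set 'M[R]_n) : set 'M[R]_n :=
  [set Y | Xspace Y /\
           forall g, Gamma0 g -> selberg X Y <= selberg (act g X) Y].

Definition Bis X Y : set 'M[R]_n :=
  [set Z | Xspace Z /\ selberg X Z = selberg Y Z].

(* Every linear form on Sym is Z |-> \tr (A *m Z) for a unique A in Sym, so the
   linear hyperplanes of Sym and the closed half-spaces they bound are
   parametrized by the nonzero A in Sym. *)
Definition hyperplane A : set 'M[R]_n := [set Z | Sym Z /\ \tr (A *m Z) = 0].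

Definition half_space A : set 'M[R]_n := [set Z | Sym Z /\ 0 <= \tr (A *m Z)].

Definition span_dim S (k : nat) : Prop :=
  exists V : {vspace 'M[R]_n},
    [/\ forall Z, S Z -> Z \in V,
        forall W : {vspace 'M[R]_n}, (forall Z, S Z -> Z \in W) -> (V <= W)%VS
      & \dim V = k].

(* A face of codimension one of a full-dimensional D: the intersection of D with
   a supporting hyperplane, spanning a hyperplane of Sym (which has dimension
   n (n + 1) / 2).  F is then nonempty as soon as n >= 2. *)
Definition facet D F : Prop :=
  exists A, [/\ Sym A, A != 0, D `<=` half_space A,
                F = D `&` hyperplane A & span_dim F 'C(n.+1, 2).-1].

(* gF F is the element g_F attached to the facet F; its values on sets that are
   not facets of D play no role. *)
Definition facet_pairing X (Gamma0 : set 'M[R]_n) D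
    (gF : set 'M[R]_n -> 'M[R]_n) : Prop :=
  forall F, facet D F ->
    let g := gF F in
    let F' := act (invmx g) @` F in
    [/\ Gamma0 g, Gamma0 (invmx g),
        F `<=` Bis X (act g X) & F = D `&` (act g @` D)] /\
    [/\ facet D F', F' `<=` Bis X (act (invmx g) X) & gF F' = invmx g].

Definition facet_step D (gF : set 'M[R]_n -> 'M[R]_n) Y Z : Prop :=
  exists F, [/\ facet D F, F Y & Z = act (invmx (gF F)) Y].

Definition facet_equiv D gF : 'M[R]_n -> 'M[R]_n -> Prop :=
  clos_refl_sym_trans _ (facet_step D gF).

(* Subsets of the projective space P(Sym) are represented by their preimages in
   Sym minus 0, i.e. by sets of nonzero matrices stable under nonzero scaling. *)
Definition projectivization (C : set 'M[R]_n) : set 'M[R]_n :=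
  [set Z | Z != 0 /\ (C Z \/ C (- Z))].

Definition satake : set 'M[R]_n :=
  projectivization [set Z | Sym Z /\ pos_semidef Z].

(* A finite intersection of half-spaces which is contained in an affine chart of
   P(Sym), namely the complement of the hyperplane of L. *)
Definition projective_polytope (P : set 'M[R]_n) : Prop :=
  exists (As : seq 'M[R]_n) (L : 'M[R]_n),
    let C := Sym `&` [set Z | forall A, A \in As -> half_space A Z] in
    [/\ forall A, A \in As -> Sym A /\ A != 0,
        Sym L, forall Z, C Z -> Z != 0 -> 0 < \tr (L *m Z)
      & P = projectivization C].

Definition finite_volume D : Prop :=
  exists P, [/\ projective_polytope P, P `<=` satake & D = P `&` Xspace].

Definition riem_inner X A B : R :=
  \tr (invmx X *m A *m invmx X *m B).

(* A C^1 path defined on [0, 1] extends to a C^1 map on the whole line, so only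
   the values on [0, 1] are constrained to lie in S. *)
Definition C1_path_in S (c : R -> 'M[R]_n) : Prop :=
  [/\ forall t : R, derivable c t 1, continuous (derive1 c)
    & forall t : R, 0 <= t <= 1 -> S (c t)].

Definition path_length (c : R -> 'M[R]_n) : \bar R :=
  \int[lebesgue_measure]_(t in `[0, 1])
    (Num.sqrt (riem_inner (c t) (derive1 c t) (derive1 c t)))%:E.

(* chain S r Y Z l: one goes from Y to Z, within S, by following finitely many
   C^1 paths of total length l and jumping for free between points related by
   r, an equivalence relation on S.  Such chains are the piecewise C^1 paths of
   the quotient S / r. *)
Inductive chain S (r : 'M[R]_n -> 'M[R]_n -> Prop) :
    'M[R]_n -> 'M[R]_n -> \bar R -> Prop :=
| chain_jump Y Z : S Y -> S Z -> r Y Z -> chain S r Y Z 0%E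
| chain_path Y Z c l : S Y -> r Y (c 0) -> C1_path_in S c ->
    chain S r (c 1) Z l -> chain S r Y Z (path_length c + l)%E.

Definition quotient_set S (r : 'M[R]_n -> 'M[R]_n -> Prop) :
    set (set 'M[R]_n) :=
  [set [set Z | S Z /\ r Y Z] | Y in S].

(* The path (pseudo)metric of S / r induced from the Riemannian metric, points
   of S / r being equivalence classes. *)
Definition quotient_dist S r (p q : set 'M[R]_n) : \bar R :=
  ereal_inf [set l | exists Y Z, [/\ p Y, q Z & chain S r Y Z l]].

Definition riem_dist Y Z : \bar R :=
  ereal_inf [set l | chain Xspace eq Y Z l].

Definition finite_subgroup (G : set 'M[R]_n) : Prop :=
  [/\ finite_set G, G `<=` SL, G 1%:M,
      forall g h, G g -> G h -> G (g *m h) & forall g, G g -> G (invmx g)].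

Definition orbit_rel (G : set 'M[R]_n) Y Z : Prop :=
  exists2 g, G g & Z = act g Y.

Definition orbit_space G : set (set 'M[R]_n) :=
  quotient_set Xspace (orbit_rel G).

Definition orbit_dist G : set 'M[R]_n -> set 'M[R]_n -> \bar R :=
  quotient_dist Xspace (orbit_rel G).

Definition dist_ball (T : Type) (M : set T) (d : T -> T -> \bar R)
    (p : T) (e : R) : set T :=
  [set q | M q /\ (d p q < e%:E)%E].

(* quotient_dist is symmetric, nonnegative and satisfies the triangle
   inequality; what may fail is finiteness and separation. *)
Definition is_metric (T : Type) (M : set T) (d : T -> T -> \bar R) : Prop :=
  forall p q, M p -> M q -> d p q \is a fin_num /\ (d p q = 0%E -> p = q).

(* (M, d) is a metric (Xspace, SL)-orbifold: it is covered by injective charts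
   phi i : U i -> Xspace / G i, with G i a finite subgroup of SL, which map small
   balls isometrically onto balls, and whose changes of charts lift locally to
   elements of SL.  A manifold is the case where all the G i are trivial. *)
Definition has_orbifold_structure
    (M : set (set 'M[R]_n)) (d : set 'M[R]_n -> set 'M[R]_n -> \bar R) : Prop :=
  is_metric M d /\
  exists (I : Type) (U : I -> set (set 'M[R]_n)) (G : I -> set 'M[R]_n)
         (phi : I -> set 'M[R]_n -> set 'M[R]_n),
    [/\ forall i, finite_subgroup (G i) /\ U i `<=` M,
        forall p, M p -> exists i, U i p,
        forall i p q, U i p -> U i q -> phi i p = phi i q -> p = q,
        forall i p, U i p -> orbit_space (G i) (phi i p) /\
          exists e : R,
            [/\ 0 < e, dist_ball M d p e `<=` U i,
                forall q q', dist_ball M d p e q -> dist_ball M d p e q' ->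
                  orbit_dist (G i) (phi i q) (phi i q') = d q q'
              & phi i @` dist_ball M d p e =
                dist_ball (orbit_space (G i)) (orbit_dist (G i)) (phi i p) e]
      & forall i j p x y, U i p -> U j p -> phi i p x -> phi j p y ->
          exists h, [/\ SL h, act h x = y &
            exists2 e : R, 0 < e &
              forall z, dist_ball Xspace riem_dist x e z ->
                exists q, [/\ U i q, U j q, phi i q z & phi j q (act h z)]]].

Definition complete_for (T : Type) (M : set T) (d : T -> T -> \bar R) : Prop :=
  forall u : nat -> T, (forall k, M (u k)) ->
    (forall e : R, 0 < e -> exists N : nat, forall j k : nat,
        (N <= j)%N -> (N <= k)%N -> (d (u j) (u k) < e%:E)%E) ->
    exists2 p, M p &
      forall e : R, 0 < e -> exists N : nat, forall k : nat,
        (N <= k)%N -> (d (u k) p < e%:E)%E.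

Definition glued_space D gF : set (set 'M[R]_n) :=
  quotient_set D (facet_equiv D gF).

Definition glued_dist D gF : set 'M[R]_n -> set 'M[R]_n -> \bar R :=
  quotient_dist D (facet_equiv D gF).

Definition tiling_condition D gF : Prop :=
  has_orbifold_structure (glued_space D gF) (glued_dist D gF).

End SymmetricSpace.

(* Main.v *)
(** Write s(Y) for the Selberg invariant tr(X^-1 Y).  A facet F lies in
    Bis(X, g.X), and s(g.X, Y) = s(X, g^-1.Y), so s takes the same value at
    points of D that are glued together and descends to M.  By Cauchy-Schwarz
    for the Riemannian metric, ln s is 1-Lipschitz, hence bounded on any Cauchy
    sequence of M; the sublevel sets of s in D being compact, representatives
    of the terms of such a sequence have a cluster point Y in D.  A point A of
    D near Y is joined to Y inside D by a short path, the segment [A, Y]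
    rescaled to determinant 1, and this yields convergence in M. *)

From mathcomp Require Import perm ring lra.
Require Import Defs.

Set Implicit Arguments.
Unset Strict Implicit.
Unset Printing Implicit Defensive.

Local Open Scope classical_set_scope.
Local Open Scope ring_scope.

(** * Quadratic forms, positivity and the trace pairing *)

Lemma discriminant_le (R : realFieldType) (a b c : R) :
  0 <= a -> (forall t, 0 <= a * t ^+ 2 + 2 * b * t + c) -> b ^+ 2 <= a * c.
Proof.
rewrite le_eqVlt => /predU1P[<-|a_gt0] H.
  (* For a = 0 the polynomial is affine; if b were nonzero it would take the value -1 at the point
     chosen below. *)
  have [->|b0] := eqVneq b 0; first by rewrite expr0n mul0r.
  have := H (- (c + 1) / (2 * b)).
  have -> : 0 * (- (c + 1) / (2 * b)) ^+ 2 + 2 * b * (- (c + 1) / (2 * b)) + c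
            = -1 by field.
  by lra.
(* The minimum of the polynomial is attained at -b/a. *)
have := H (- b / a).
have -> : a * (- b / a) ^+ 2 + 2 * b * (- b / a) + c = (a * c - b ^+ 2) / a.
  by field; rewrite gt_eqF.
by rewrite pmulr_lge0 ?invr_gt0// subr_ge0.
Qed.

Section QuadraticForms.
Context {R : realType} {n : nat}.
Implicit Types (P Q X Y A B : 'M[R]_n) (v w : 'cV[R]_n).

Lemma mx11_tr (M : 'M[R]_1) : M^T = M.
Proof. by apply/matrixP => i j; rewrite mxE !ord1. Qed.

Lemma qform_sym P v w (sP : Sym P) : (v^T *m P *m w) 0 0 = (w^T *m P *m v) 0 0.
Proof.
by rewrite -[in LHS](mx11_tr (v^T *m P *m w)) !trmx_mul trmxK sP mulmxA.
Qed.

Lemma qform_cauchy_schwarz P v w : Sym P -> pos_semidef P ->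
  (v^T *m P *m w) 0 0 ^+ 2 <= (v^T *m P *m v) 0 0 * (w^T *m P *m w) 0 0.
Proof.
move=> sP pP; apply: discriminant_le => // t.
have := pP (t *: v + w).
suff -> : ((t *: v + w)^T *m P *m (t *: v + w)) 0 0 =
   (v^T *m P *m v) 0 0 * t ^+ 2 + 2 * (v^T *m P *m w) 0 0 * t +
   (w^T *m P *m w) 0 0 by [].
have -> : (t *: v + w)^T = t *: v^T + w^T by rewrite linearP.
rewrite !mulmxDl !mulmxDr -!scalemxAl -!scalemxAr.
have E (M N : 'M[R]_1) : (M + N) 0 0 = M 0 0 + N 0 0 by rewrite mxE.
have Z (M : 'M[R]_1) : (t *: M) 0 0 = t * M 0 0 by rewrite mxE.
by rewrite !(E, Z) (qform_sym w v sP); ring.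
Qed.

Lemma pos_def_semidef P : pos_def P -> pos_semidef P.
Proof.
move=> pP v; have [->|v0] := eqVneq v 0; first by rewrite mulmx0 mxE.
exact/ltW/pP.
Qed.

(** If the form vanishes at v, Cauchy-Schwarz against each basis vector gives P v = 0, and
    invertibility gives v = 0. *)
Lemma semidef_unit_pos_def P :
  Sym P -> pos_semidef P -> P \in unitmx -> pos_def P.
Proof.
move=> sP pP uP v v0; rewrite lt_neqAle pP andbT; apply: contra_neq v0 => qv.
suff Pv0 : P *m v = 0 by rewrite -(mulKmx uP v) Pv0 mulmx0.
apply/colP => i; rewrite [RHS]mxE.
have := qform_cauchy_schwarz (delta_mx i 0) v sP pP.
rewrite -qv mulr0 -mulmxA trmx_delta -rowE => h.
by apply/eqP; rewrite -sqrf_eq0 eq_le sqr_ge0 andbT mxE in h *.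
Qed.

Lemma pos_def_unitmx P : pos_def P -> P \in unitmx.
Proof.
move=> pP; rewrite -unitmx_tr -row_free_unit -kermx_eq0; apply/eqP/row_matrixP => i.
rewrite row0; apply/eqP; apply: contraT => k0.
have := pP (row i (kermx P^T))^T; rewrite trmx_eq0 -mulmxA => /(_ k0).
have -> : P *m (row i (kermx P^T))^T = 0.
  by apply: trmx_inj; rewrite trmx_mul trmxK -row_mul mulmx_ker row0 trmx0.
by rewrite mulmx0 mxE ltxx.
Qed.

Lemma Sym_invmx P : Sym P -> Sym (invmx P).
Proof. by move=> sP; rewrite /Sym /= trmx_inv sP. Qed.

Lemma qform_invmx P v : Sym P -> P \in unitmx ->
  (v^T *m invmx P *m v) 0 0 =
  ((invmx P *m v)^T *m P *m (invmx P *m v)) 0 0.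
Proof.
by move=> sP uP; rewrite trmx_mul Sym_invmx// !mulmxA mulmxKV// -mulmxA.
Qed.

Lemma pos_def_invmx P : Sym P -> pos_def P -> pos_def (invmx P).
Proof.
move=> sP pP v v0; have uP := pos_def_unitmx pP.
rewrite qform_invmx//; apply: pP; apply: contra_neq v0 => h.
by rewrite -(mulKVmx uP v) h mulmx0.
Qed.

End QuadraticForms.

(* Induction on the size: P is a rank one matrix plus its Schur complement. *)
Lemma mxtrace_mul_ge0 (R : realType) (n : nat) (P Q : 'M[R]_n) :
  Sym P -> pos_def P -> pos_semidef Q -> 0 <= \tr (P *m Q).
Proof.
elim: n => [|n IHn] in P Q *.
  by move=> _ _ _; rewrite /mxtrace big_ord0.
rewrite -[n.+1]/(1 + n)%N in P Q * => sP pP pQ.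
pose a := P 0 0; pose b := dlsubmx P; pose w := col_mx (a%:M : 'M[R]_1) b.
pose S := drsubmx P - a^-1 *: (b *m b^T).
have a_gt0 : 0 < a.
  have := pP (delta_mx 0 0); rewrite trmx_delta -rowE -colE !mxE; apply.
  by apply/eqP => /matrixP /(_ 0 0) /eqP; rewrite !mxE /= oner_eq0.
have PE : P = a^-1 *: (w *m w^T) + block_mx 0 0 0 S.
  rewrite /w tr_col_mx mul_col_row scale_block_mx add_block_mx !addr0.
  rewrite tr_scalar_mx -scalar_mxM mul_scalar_mx mul_mx_scalar !scalerA.
  rewrite mulVf ?gt_eqF// !scale1r [_ + S]addrC subrK -[LHS]submxK.
  congr block_mx.
    apply/matrixP => i j; rewrite !ord1 !mxE !eqxx !mulr1n.
    by rewrite mulKf ?gt_eqF//; congr (P _ _); exact: val_inj.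
  by rewrite /b trmx_dlsub sP.
have -> : \tr (P *m Q) = a^-1 * (w^T *m Q *m w) 0 0 + \tr (S *m drsubmx Q).
  rewrite [in LHS]PE mulmxDl linearD /=; congr (_ + _).
    by rewrite -scalemxAl linearZ /= -mulmxA mxtrace_mulC trace_mx11.
  rewrite -[X in _ *m X]submxK mulmx_block mxtrace_block.
  by rewrite !mul0mx !add0r linear0 add0r.
apply: addr_ge0; first by rewrite mulr_ge0// invr_ge0 ltW.
apply: IHn.
- rewrite /S /Sym /= linearB linearZ /= trmx_mul trmxK trmx_drsub.
  by rewrite sP.
- move=> u u0.
  (* The first coordinate x is chosen so that v = (x, u) is orthogonal to w; the rank one part then
     vanishes at v and P takes there the value of the Schur complement at u. *)
  pose x : 'M[R]_1 := - a^-1 *: (b^T *m u); pose v := col_mx x u.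
  have v0 : v != 0.
    by apply: contra_neq u0 => /(congr1 dsubmx); rewrite col_mxKd linear0.
  have wv0 : w^T *m v = 0.
    rewrite /w tr_col_mx mul_row_col tr_scalar_mx mul_scalar_mx /x.
    by rewrite scalerA mulrN mulfV ?gt_eqF// scaleN1r addNr.
  have := pP v v0.
  rewrite PE mulmxDr mulmxDl -scalemxAr -!mulmxA.
  rewrite -scalemxAl -!mulmxA wv0 !mulmx0 scaler0 add0r.
  rewrite /v tr_col_mx mul_block_col !mul0mx !add0r mul_row_col mulmx0 add0r.
  by rewrite mulmxA.
- move=> u; have := pQ (col_mx 0 u).
  rewrite -{1}[Q]submxK -mulmxA mul_block_col !mulmx0 !add0r tr_col_mx mul_row_col.
  by rewrite trmx0 mul0mx add0r mulmxA.
Qed.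

(** * The Selberg invariant and the Riemannian metric *)

Section Selberg.
Context {R : realType} {n : nat}.
Implicit Types (P Q X Y A B M : 'M[R]_n) (v w : 'cV[R]_n).

Lemma pos_semidef_congr M Q : pos_semidef Q -> pos_semidef (M^T *m Q *m M).
Proof.
by move=> pQ v; have := pQ (M *m v); rewrite trmx_mul !mulmxA.
Qed.

(* The trace of Y against v v^T <= (v^T X v) X^-1. *)
Lemma qform_le_selberg X Y v : Sym X -> pos_def X -> Sym Y -> pos_def Y ->
  (v^T *m Y *m v) 0 0 <= (v^T *m X *m v) 0 0 * selberg X Y.
Proof.
move=> sX pX sY pY; have uX := pos_def_unitmx pX.
rewrite -subr_ge0.
have -> : (v^T *m X *m v) 0 0 * selberg X Y - (v^T *m Y *m v) 0 0 =
    \tr (Y *m ((v^T *m X *m v) 0 0 *: invmx X - v *m v^T)).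
  rewrite mulmxBr linearB -scalemxAr linearZ /= (mxtrace_mulC Y (invmx X)).
  congr (_ - _).
  by rewrite (mulmxA Y) mxtrace_mulC mulmxA trace_mx11.
apply: mxtrace_mul_ge0 => // w.
(* Positivity of (v^T X v) X^-1 - v v^T at w is Cauchy-Schwarz for X between v and X^-1 w, whose
   product is v^T w. *)
have := qform_cauchy_schwarz v (invmx X *m w) sX (pos_def_semidef pX).
rewrite -qform_invmx//.
have -> : (v^T *m X *m (invmx X *m w)) 0 0 ^+ 2 = (w^T *m (v *m v^T) *m w) 0 0.
  rewrite -mulmxA mulKVmx// mulmxA -[RHS]trace_mx11 -mulmxA mxtrace_mulC.
  rewrite -(mx11_tr (w^T *m v)) trmx_mul trmxK.
  by rewrite [v^T *m w]mx11_scalar -scalar_mxM trace_mx11 !mxE /= mulr1n expr2.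
rewrite -subr_ge0 => h.
rewrite mulmxBr mulmxBl -scalemxAr -scalemxAl.
rewrite (_ : forall a (M N : 'M[R]_1), (a *: M - N) 0 0 = a * M 0 0 - N 0 0)//.
by move=> *; rewrite !mxE.
Qed.

(** The trace pairs X^-1 with A^T X^-1 A, which is positive semidefinite. *)
Lemma riem_inner_ge0 X A :
  Sym X -> pos_def X -> Sym A -> 0 <= riem_inner X A A.
Proof.
move=> sX pX sA; rewrite /riem_inner -!mulmxA.
apply: mxtrace_mul_ge0; [exact: Sym_invmx|exact: pos_def_invmx|].
rewrite mulmxA -{1}sA; apply/pos_semidef_congr/pos_def_semidef.
exact: pos_def_invmx.
Qed.

Lemma riem_inner_cauchy_schwarz X A B : Sym X -> pos_def X -> Sym A -> Sym B ->
  riem_inner X A B ^+ 2 <= riem_inner X A A * riem_inner X B B.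
Proof.
move=> sX pX sA sB; apply: discriminant_le; first exact: riem_inner_ge0.
move=> t; have := @riem_inner_ge0 X (t *: A + B) sX pX.
have -> : riem_inner X (t *: A + B) (t *: A + B) = riem_inner X A A * t ^+ 2 +
    2 * riem_inner X A B * t + riem_inner X B B.
  have BA : riem_inner X B A = riem_inner X A B.
    by rewrite /riem_inner -mulmxA mxtrace_mulC mulmxA.
  rewrite /riem_inner in BA *.
  rewrite !(mulmxDr, mulmxDl, =^~ scalemxAl, =^~ scalemxAr) !linearD /= !linearZ /= BA.
  by ring.
by apply; rewrite /Sym /= linearP /= sA sB.
Qed.

(** The eigenvalues of X^-1 Y are positive, so the sum of their squares is at most the square of
    their sum. Without eigenvalues: with s = tr(X^-1 Y), the matrix Q = s X - Y is semidefinite, and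
    pairing Y with X^-1 Q X^-1 gives s^2 - tr(X^-1 Y X^-1 Y) >= 0. *)
Lemma riem_inner_le_selberg X Y : Sym X -> pos_def X -> Sym Y -> pos_def Y ->
  riem_inner X Y Y <= selberg X Y ^+ 2.
Proof.
move=> sX pX sY pY; rewrite -subr_ge0.
pose Q := selberg X Y *: X - Y.
have pQ : pos_semidef Q.
  move=> v; have := qform_le_selberg v sX pX sY pY; rewrite -subr_ge0.
  rewrite /Q mulmxBr mulmxBl -scalemxAr -scalemxAl.
  rewrite (_ : forall a (M N : 'M[R]_1), (a *: M - N) 0 0 = a * M 0 0 - N 0 0).
    by rewrite mulrC.
  by move=> *; rewrite !mxE.
have := mxtrace_mul_ge0 sY pY (@pos_semidef_congr (invmx X) _ pQ).
rewrite Sym_invmx// /Q !(mulmxBr, mulmxBl) -!(scalemxAl, scalemxAr).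
rewrite linearB linearZ /= mulVmx ?pos_def_unitmx// mul1mx.
by rewrite (mxtrace_mulC Y (invmx X)) (mxtrace_mulC Y) -/(selberg X Y) -expr2.
Qed.

(* Cauchy-Schwarz between A and Y X^-1 Y, since <A, Y X^-1 Y>_Y = tr(X^-1 A). *)
Lemma selberg_sqr_le X Y A :
  Sym X -> pos_def X -> Sym Y -> pos_def Y -> Sym A ->
  selberg X A ^+ 2 <= selberg X Y ^+ 2 * riem_inner Y A A.
Proof.
move=> sX pX sY pY sA; have uY := pos_def_unitmx pY.
have sB : Sym (Y *m invmx X *m Y).
  by rewrite /Sym /= !trmx_mul sY Sym_invmx// mulmxA.
have := riem_inner_cauchy_schwarz sY pY sA sB.
have -> : riem_inner Y A (Y *m invmx X *m Y) = selberg X A.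
  rewrite /riem_inner /selberg !mulmxA mulmxKV// mxtrace_mulC !mulmxA mulmxV//.
  by rewrite mul1mx mxtrace_mulC.
move/le_trans; apply; rewrite mulrC ler_wpM2r ?riem_inner_ge0//.
(* The squared norm of Y X^-1 Y at Y is tr(X^-1 Y X^-1 Y), that is [riem_inner X Y Y]. *)
apply: le_trans (riem_inner_le_selberg sX pX sY pY).
by rewrite /riem_inner !mulmxA mulVmx// mul1mx mulmxKV.
Qed.

End Selberg.

(** The size [n.+1] provides a nonzero vector v, and 0 < v^T Y v <= (v^T X v) s(X, Y). *)
Lemma selberg_gt0 (R : realType) (n : nat) (X Y : 'M[R]_n.+1) :
  Sym X -> pos_def X -> Sym Y -> pos_def Y -> 0 < selberg X Y.
Proof.
move=> sX pX sY pY; pose v : 'cV[R]_n.+1 := delta_mx 0 0.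
have v0 : v != 0.
  by apply/eqP => /matrixP /(_ 0 0) /eqP; rewrite !mxE /= oner_eq0.
have := lt_le_trans (pY v v0) (qform_le_selberg v sX pX sY pY).
by rewrite pmulr_rgt0// pX.
Qed.

(** * Limits of matrix operations along a filter *)

Section MatrixLimits.
Context {R : realType} {T : Type} {F : set_system T} {FF : Filter F}.

Lemma mx_cvg m n (f : T -> 'M[R]_(m, n)) (M : 'M[R]_(m, n)) :
  (forall i j, f t i j @[t --> F] --> M i j) -> f t @[t --> F] --> M.
Proof.
move=> fM A [P MP PA]; apply: (@filterS _ F FF _ _ (fun t => PA (f t))).
apply: filter_forall => i; apply: filter_forall => j.
exact: fM (MP i j).
Qed.

Lemma mx_entry_cvg m n (f : T -> 'M[R]_(m, n)) (M : 'M[R]_(m, n)) i j :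
  f t @[t --> F] --> M -> f t i j @[t --> F] --> M i j.
Proof.
move=> fM; apply: (cvg_comp f (fun N : 'M[R]_(m, n) => N i j) fM).
exact: coord_continuous.
Qed.

Lemma mulmx_cvg m n p (f : T -> 'M[R]_(m, n)) (g : T -> 'M[R]_(n, p))
    (A : 'M[R]_(m, n)) (B : 'M[R]_(n, p)) :
  f t @[t --> F] --> A -> g t @[t --> F] --> B ->
  f t *m g t @[t --> F] --> A *m B.
Proof.
move=> fA gB; apply: mx_cvg => i j; rewrite mxE.
under eq_fun do rewrite mxE.
apply: cvg_big => [|k _]; first exact: add_continuous.
by apply: cvgM; exact: mx_entry_cvg.
Qed.

Lemma mxtrace_cvg n (f : T -> 'M[R]_n) (A : 'M[R]_n) :
  f t @[t --> F] --> A -> \tr (f t) @[t --> F] --> \tr A.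
Proof.
move=> fA; apply: cvg_big => [|i _]; first exact: add_continuous.
exact: mx_entry_cvg.
Qed.

Lemma det_cvg n (f : T -> 'M[R]_n) (A : 'M[R]_n) :
  f t @[t --> F] --> A -> \det (f t) @[t --> F] --> \det A.
Proof.
move=> fA; apply: cvg_big => [|s _]; first exact: add_continuous.
apply: cvgM; first exact: cvg_cst.
apply: cvg_big => [|i _]; first exact: mul_continuous.
exact: mx_entry_cvg.
Qed.

Lemma adj_cvg n (f : T -> 'M[R]_n) (A : 'M[R]_n) :
  f t @[t --> F] --> A -> \adj (f t) @[t --> F] --> \adj A.
Proof.
move=> fA; apply: mx_cvg => i j; rewrite mxE; under eq_fun do rewrite mxE.
apply: cvgM; first exact: cvg_cst.
apply: det_cvg; apply: mx_cvg => k l; rewrite !mxE.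
by under eq_fun do rewrite !mxE; exact: mx_entry_cvg.
Qed.

End MatrixLimits.

(** * The logarithm of the Selberg invariant is 1-Lipschitz along paths *)

Section Lipschitz.
Context {R : realType} {n : nat}.
Implicit Types (X Y Z : 'M[R]_n.+1) (S : set 'M[R]_n.+1) (c : R -> 'M[R]_n.+1).

Lemma derivable_cvg (V : normedModType R) (f : R -> V) (t : R) :
  derivable f t 1 -> f u @[u --> t] --> f t.
Proof. by move=> /derivable1_diffP/differentiable_continuous. Qed.

Lemma is_derive_mxtrace_mul X c t : derivable c t 1 ->
  is_derive t 1 (fun u => \tr (X *m c u)) (\tr (X *m derive1 c t)).
Proof.
move=> dc.
have -> : (fun u => \tr (X *m c u)) =
    \sum_(i < n.+1) \sum_(j < n.+1) (fun u => X i j * c u j i).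
  apply/funext => u; rewrite fct_sumE; apply: eq_bigr => i _.
  by rewrite fct_sumE mxE.
have D i j : is_derive t 1 (fun u => X i j * c u j i) (X i j * derive1 c t j i).
  apply: (@is_deriveZ _ _ _ (fun u => c u j i)).
  rewrite derive1E derive_mx// mxE; apply: derivableP.
  exact: (derivable_mxP c t 1).1.
apply: is_derive_eq.
rewrite /mxtrace; apply: eq_bigr => i _; rewrite mxE; reflexivity.
Qed.

(** Symmetry of c is known on [0, 1] only, so t is taken in the interior: there the entries (i, j)
    and (j, i) of c agree on a neighbourhood of t. *)
Lemma Sym_derive1 c t : (forall u : R, 0 <= u <= 1 -> Sym (c u)) -> 0 < t < 1 ->
  derivable c t 1 -> Sym (derive1 c t).
Proof.
move=> sc /andP[t0 t1] dc; apply/matrixP => i j.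
rewrite derive1E derive_mx// !mxE; apply: near_eq_derive.
near=> u; suff /sc/matrixP/(_ i j) : 0 <= u <= 1 by rewrite mxE.
by apply/andP; split; apply: ltW; near: u; [exact: lt_nbhsr|exact: lt_nbhsl].
Unshelve. all: by end_near. Qed.

End Lipschitz.

Section Lipschitz.
Context {R : realType} {n : nat}.
Implicit Types (X Y Z : 'M[R]_n.+1) (S : set 'M[R]_n.+1) (c : R -> 'M[R]_n.+1).
Notation mu := (@lebesgue_measure R).

Definition speed c (t : R) : R :=
  Num.sqrt (riem_inner (c t) (derive1 c t) (derive1 c t)).

Lemma speed_continuous c : C1_path_in (@Xspace R n.+1) c ->
  {within `[0, 1], continuous (speed c)}.
Proof.
move=> [dc c'c cX].
(* On [0, 1] the determinant is 1 and the inverse is the adjugate. The expression with adjugates is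
   continuous on the whole line, even where c leaves [Xspace]. *)
pose g t := Num.sqrt (\tr (\adj (c t) *m derive1 c t *m \adj (c t) *m derive1 c t)).
apply: (@subspace_eq_continuous _ _ _ g).
  move=> t; rewrite inE /= in_itv /= => /cX[_ dt _].
  by rewrite /g /from_subspace /speed /riem_inner /invmx unitmxE dt unitr1 invr1 scale1r.
apply: continuous_subspaceT => t.
apply: continuous_comp; last exact: sqrt_continuous.
apply: mxtrace_cvg; do ! apply: mulmx_cvg; do ? exact: c'c.
  by apply: adj_cvg; exact: derivable_cvg.
by apply: adj_cvg; exact: derivable_cvg.
Qed.

(** The derivative of ln s along c is s(c') / s(c), which [selberg_sqr_le] bounds by the speed; the
    bound is integrated over [0, 1]. *)
Lemma ln_selberg_path X c : Xspace X -> C1_path_in (@Xspace R n.+1) c ->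
  ((ln (selberg X (c 1)) - ln (selberg X (c 0)))%:E <= path_length c)%E.
Proof.
move=> [sX _ pX] pc; have [dc c'c cX] := pc.
have s_gt0 (t : R) : 0 <= t <= 1 -> 0 < selberg X (c t).
  by move=> /cX[sc _ pc']; exact: selberg_gt0.
have ds (t : R) : is_derive t 1 (fun u => selberg X (c u)) (selberg X (derive1 c t)).
  exact: is_derive_mxtrace_mul.
pose h (t : R) := (selberg X (c t))^-1 * selberg X (derive1 c t).
have dh (t : R) : 0 <= t <= 1 -> is_derive t 1 (fun u => ln (selberg X (c u))) (h t).
  move=> t01; apply: is_derive1_comp; exact: is_derive1_ln (s_gt0 t t01).
have h_cont : {within `[0, 1], continuous h}.
  apply: continuous_in_subspaceT => t; rewrite inE /= in_itv /= => t01.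
  apply: cvgM.
    apply: cvgV; first by rewrite gt_eqF// s_gt0.
    by apply: (derivable_cvg (f := fun u => selberg X (c u))); have [] := ds t.
  by apply: mxtrace_cvg; apply: mulmx_cvg; [exact: cvg_cst|exact: c'c].
have ln_cont (t : R) : 0 <= t <= 1 ->
    ln (selberg X (c u)) @[u --> t] --> ln (selberg X (c t)).
  move=> t01.
  by apply: (derivable_cvg (f := fun u => ln (selberg X (c u)))); have [] := dh t t01.
have FTC : (\int[mu]_(t in `[0%R, 1%R]) (h t)%:E =
    (ln (selberg X (c 1)))%:E - (ln (selberg X (c 0)))%:E)%E.
  apply: (@continuous_FTC2 _ h (fun u => ln (selberg X (c u)))) => //.
    split.
    - by move=> t; rewrite in_itv /= => /andP[t0 t1]; have [] := dh t; rewrite ?ltW.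
    - by apply: cvg_at_right_filter; apply: ln_cont; rewrite lexx ler01.
    - by apply: cvg_at_left_filter; apply: ln_cont; rewrite lexx ler01.
  move=> t; rewrite in_itv /= => /andP[t0 t1]; rewrite derive1E.
  by have [] := dh t; rewrite ?ltW.
rewrite /path_length.
have i_h : mu.-integrable `[0, 1] (EFin \o h).
  by apply: continuous_compact_integrable; first exact: segment_compact.
have i_g : mu.-integrable `[0, 1] (EFin \o speed c).
  apply: continuous_compact_integrable; first exact: segment_compact.
  exact: speed_continuous.
have itv_int (a b : itv_bound R) (f : R -> R) : [set` Interval a b] `<=` `[0, 1] ->
    mu.-integrable `[0, 1] (EFin \o f) -> mu.-integrable [set` Interval a b] (EFin \o f).
  by move=> sub i_f; apply: integrableS i_f.
have sub01 : `]0%R, 1%R[ `<=` (`[0%R, 1%R] : set R) by apply: subset_itv_oo_cc.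
have subco : `[0%R, 1%R[ `<=` (`[0%R, 1%R] : set R) by apply: subset_itvl; rewrite bnd_simp.
(* Both endpoints are removed from the integrals, since the integrands are compared only where
   [Sym_derive1] makes c' symmetric. *)
rewrite EFinB -FTC /path_length -!(@integral_itv_bndo_bndc _ (BLeft 0)).
- rewrite -!(@integral_itv_obnd_cbnd _ 0).
  + apply: le_integral => //.
    * exact: integrableS i_h.
    * exact: integrableS i_g.
    move=> t; rewrite inE /= in_itv /= => t01; rewrite lee_fin.
    have t01' : 0 <= t <= 1 by case/andP: t01 => t0 t1; rewrite !ltW.
    have [sc _ p_c] := cX t t01'.
    have sc' : Sym (derive1 c t).
      by apply: Sym_derive1 => // u /cX[].
    rewrite /h mulrC ler_pdivrMr ?s_gt0// mulrC.
    apply: le_trans (ler_norm _) _.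
    rewrite -sqrtr_sqr -[X in _ <= X * _]gtr0_norm ?s_gt0// -[X in _ <= X * _]sqrtr_sqr.
    rewrite -sqrtrM ?sqr_ge0// ler_wsqrtr// selberg_sqr_le//.
  + by have /integrableP[] := itv_int _ _ _ sub01 i_g.
  + by have /integrableP[] := itv_int _ _ _ sub01 i_h.
- by have /integrableP[] := itv_int _ _ _ subco i_g.
- by have /integrableP[] := itv_int _ _ _ subco i_h.
Qed.

End Lipschitz.

(** * Chains of paths and jumps *)

Section Chains.
Context {R : realType} {n : nat}.
Implicit Types (X Y Z W : 'M[R]_n.+1) (S : set 'M[R]_n.+1).
Implicit Types (r : 'M[R]_n.+1 -> 'M[R]_n.+1 -> Prop).

Lemma ln_selberg_chain X S r Y Z l : Xspace X -> S `<=` @Xspace R n.+1 ->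
  (forall U V, S U -> S V -> r U V -> selberg X U = selberg X V) ->
  chain S r Y Z l -> ((ln (selberg X Z) - ln (selberg X Y))%:E <= l)%E.
Proof.
move=> XX SX inv; elim=> {Y Z l} [Y Z SY SZ YZ|Y Z c l SY Yc0 pc _ IH].
  by rewrite (inv Y Z)// subrr.
have [dc c'c cS] := pc.
have c0S : S (c 0) by apply: cS; rewrite lexx ler01.
have pcX : C1_path_in (@Xspace R n.+1) c by split=> // t /cS /SX.
rewrite (inv Y (c 0))//.
rewrite -(subrKA (ln (selberg X (c 1)))) EFinD addeC.
by apply: leeD => //; exact: ln_selberg_path.
Qed.

(** Either constructor of a chain starts with a jump, into which the new one is absorbed by
    transitivity. *)
Lemma chain_jumpl S r Y Z W l : (forall A B C, r A B -> r B C -> r A C) ->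
  S Y -> r Y Z -> chain S r Z W l -> chain S r Y W l.
Proof.
move=> rT SY YZ ch; case: ch YZ => [A B SA SB AB|A B c k SA Ac pc ch] YA.
  by apply: chain_jump => //; exact: rT AB.
by apply: chain_path ch => //; exact: rT Ac.
Qed.

Lemma chain_cat S r Y Z W l k : (forall A B C, r A B -> r B C -> r A C) ->
  chain S r Y Z l -> chain S r Z W k -> chain S r Y W (l + k).
Proof.
move=> rT; elim=> {Y Z l} [A B SA SB AB|A B c l SA Ac pc _ IH] BW.
  by rewrite add0e; exact: chain_jumpl BW.
by rewrite -addeA; apply: chain_path => //; exact: IH.
Qed.

End Chains.

(** * Invariance of the Selberg invariant under the facet pairing *)

Section FacetPairing.
Context {R : realType} {n : nat}.
Implicit Types (X Y Z : 'M[R]_n.+1) (D : set 'M[R]_n.+1).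

(** The inverse of g^T X g is g^-1 X^-1 (g^-1)^T, and cyclicity of the trace moves g^-1 to the right
    of Y. *)
Lemma selberg_act X Y g : X \in unitmx -> g \in unitmx ->
  selberg (act g X) Y = selberg X (act (invmx g) Y).
Proof.
move=> uX ug; have ugT : g^T \in unitmx by rewrite unitmx_tr.
have uA : act g X \in unitmx by rewrite /act !unitmx_mul ugT uX.
have -> : selberg (act g X) Y = \tr (invmx g *m invmx X *m (invmx g)^T *m Y).
  congr (\tr (_ *m Y)); rewrite -[RHS](mulKmx uA) /act trmx_inv -!mulmxA.
  by rewrite (mulKVmx ug) (mulKVmx uX) mulmxV// mulmx1.
by rewrite /selberg /act -!mulmxA mxtrace_mulC !mulmxA.
Qed.

Lemma selberg_facet_equiv X Gamma0 D gF Y Z :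
  X \in unitmx -> Gamma0 `<=` @SL R n.+1 -> facet_pairing X Gamma0 D gF ->
  facet_equiv D gF Y Z -> selberg X Y = selberg X Z.
Proof.
move=> uX GSL pair; elim=> {Y Z} [Y Z|Y|Y Z _ ->|Y Z W _ -> _ ->]//.
move=> [F [fF FY ->]]; have [[Gg _ FBis _] _] := pair F fF.
have [_ ->] := FBis Y FY; apply: selberg_act => //.
by rewrite unitmxE (GSL _ Gg) unitr1.
Qed.

Lemma facet_equiv_trans D gF Y Z W : facet_equiv D gF Y Z ->
  facet_equiv D gF Z W -> facet_equiv D gF Y W.
Proof. exact: rst_trans. Qed.

End FacetPairing.

(** * Compactness of the sublevel sets of the Selberg invariant *)

Section Compactness.
Context {R : realType}.

Lemma mx_box_compact m n (C : R) :
  compact [set M : 'M[R]_(m, n) | forall i j, `|M i j| <= C].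
Proof.
pose K := [set v : 'rV[R]_(m * n) | forall i, v 0 i \in `[- C, C]].
have cK : compact K.
  apply: (@rV_compact _ _ (fun=> `[- C, C]%classic)) => _.
  exact: segment_compact.
have -> : [set M : 'M[R]_(m, n) | forall i j, `|M i j| <= C] = vec_mx @` K.
  apply/seteqP; split=> [M MC|_ [v vK <-] i j]; last first.
    by rewrite mxE ler_norml; have := vK (mxvec_index i j); rewrite in_itv.
  exists (mxvec M); last exact: mxvecK.
  move=> k; case/mxvec_indexP: k => i j.
  by rewrite mxvecE in_itv /= -ler_norml.
apply: continuous_compact => //; apply: continuous_subspaceT => v.
apply: (@mx_cvg _ _ (nbhs (v : 'rV[R]_(m * n)))) => i j; rewrite mxE; under eq_fun do rewrite mxE.
exact: coord_continuous.
Qed.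

Lemma qform_cvg n T (F : set_system T) (FF : Filter F) (f : T -> 'M[R]_n)
    (Y : 'M[R]_n) (v : 'cV[R]_n) : f t @[t --> F] --> Y ->
  (v^T *m f t *m v) 0 0 @[t --> F] --> (v^T *m Y *m v) 0 0.
Proof.
move=> fY; apply: mx_entry_cvg; do ! apply: mulmx_cvg => //; exact: cvg_cst.
Qed.

(** Symmetry, determinant 1 and v^T Y v >= 0 are closed conditions; strict positivity survives in
    the limit because a semidefinite matrix of determinant 1 is invertible, hence definite. *)
Lemma closed_Xspace n : closed (@Xspace R n).
Proof.
move=> Y clY.
have lim (f : 'M[R]_n -> R) (C : set R) : closed C ->
    (forall Z, Xspace Z -> C (f Z)) -> {for Y, continuous f} -> C (f Y).
  move=> cC XC fY; apply: cC => U /fY fU.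
  by have [Z [/XC CZ UZ]] := clY _ fU; exists (f Z).
have sY : Sym Y.
  apply/matrixP => i j; rewrite mxE; apply/eqP; rewrite -subr_eq0; apply/eqP.
  apply: (lim (fun M => M j i - M i j) [set 0]).
  - exact: closed_eq.
  - by move=> Z [/matrixP/(_ i j) sZ _ _] /=; rewrite -sZ mxE subrr.
  - apply: (@cvgB _ _ _ (nbhs Y) _ (fun M : 'M[R]_n => M j i) (fun M => M i j));
      exact: coord_continuous.
have dY : \det Y = 1.
  apply: (lim (fun M => \det M) [set 1]).
  - exact: closed_eq.
  - by move=> Z [].
  - by apply: (@det_cvg _ _ (nbhs Y) _ n id); exact: cvg_id.
split=> //; apply: semidef_unit_pos_def => //; last by rewrite unitmxE dY unitr1.
move=> v; apply: (lim (fun M => (v^T *m M *m v) 0 0) [set x | 0 <= x]).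
- exact: closed_ge.
- by move=> Z [_ _ /pos_def_semidef pZ]; exact: pZ.
- by apply: (@qform_cvg n _ (nbhs Y) _ id); exact: cvg_id.
Qed.

(** The set is closed and lies in a box: Y_kk <= X_kk s(X, Y) bounds the diagonal, and Y_ij^2 <=
    Y_ii Y_jj bounds the other entries. *)
Lemma DS_sublevel_compact n (X : 'M[R]_n) Gamma0 (C : R) : Xspace X ->
  compact (DS X Gamma0 `&` [set Y | selberg X Y <= C]).
Proof.
move=> [sX _ pX].
pose q (i : 'I_n) := ((delta_mx i 0 : 'cV[R]_n)^T *m X *m delta_mx i (0 : 'I_1)) 0 0.
(* The [q i] are the diagonal entries of X; their sum b, the trace of X, bounds them all at once. *)
have q_ge0 (i : 'I_n) : 0 <= q i by exact: pos_def_semidef.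
pose b := \sum_i q i.
have qb (i : 'I_n) : q i <= b by rewrite /b (bigD1 i)//= lerDl sumr_ge0.
have selb_cvg A (Y : 'M[R]_n) : {for Y, continuous (selberg A)}.
  apply: (@mxtrace_cvg _ _ (nbhs Y)); apply: (@mulmx_cvg _ _ (nbhs Y)).
    exact: cvg_cst.
  exact: cvg_id.
apply: (subclosed_compact _ (@mx_box_compact n n (b * C))).
  apply: closedI.
    have -> : DS X Gamma0 = @Xspace R n `&`
        \bigcap_(g in Gamma0) [set Y | selberg X Y <= selberg (act g X) Y].
      by apply/seteqP; split=> Y [YX YG]; split=> // g; exact: YG.
    apply: closedI; first exact: closed_Xspace.
    apply: closed_bigI => g _.
    rewrite (_ : mkset _ =
        (fun Y => selberg (act g X) Y - selberg X Y) @^-1` [set x | 0 <= x]).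
      apply: closed_comp; last exact: closed_ge.
      move=> Y _; apply: (@cvgB _ _ _ (nbhs Y) _ (selberg (act g X)) (selberg X));
        exact: selb_cvg.
    by apply/seteqP; split=> Y /=; rewrite subr_ge0.
  apply: (@closed_comp _ _ (selberg X) [set x | x <= C]); last exact: closed_le.
  by move=> Y _; exact: selb_cvg.
move=> Y [[[sY _ pY] _] YC] i j /=.
have YE k l : Y k l = ((delta_mx k 0 : 'cV[R]_n)^T *m Y *m delta_mx l (0 : 'I_1)) 0 0.
  by rewrite trmx_delta -rowE -colE !mxE.
have Yb k : 0 <= Y k k <= b * C.
  rewrite YE pos_def_semidef//=.
  apply: le_trans (qform_le_selberg _ sX pX sY pY) _.
  apply: ler_pM (q_ge0 k) _ (qb k) YC; rewrite /selberg;
  apply: mxtrace_mul_ge0; [exact: Sym_invmx|exact: pos_def_invmx|].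
  exact: pos_def_semidef.
have := qform_cauchy_schwarz (delta_mx i 0) (delta_mx j 0) sY (pos_def_semidef pY).
rewrite -!YE => h.
have /andP[Yi0 Yi] := Yb i; have /andP[Yj0 Yj] := Yb j.
have bC : 0 <= b * C := le_trans Yi0 Yi.
rewrite -ler_sqr ?nnegrE// real_normK ?num_real//.
by apply: le_trans h _; rewrite expr2 ler_pM.
Qed.

End Compactness.

(** * Derivative of the determinant *)

Section DetDerivative.
Context {R : realType}.

(** The Leibniz rule, by induction on r; as r has no repetition, the test [i == k] singles out
    exactly one factor. *)
Lemma is_derive_prod (I : eqType) (r : seq I) (f : I -> R -> R) (df : I -> R)
    (t : R) : uniq r -> (forall i, is_derive t 1 (f i) (df i)) ->
  is_derive t 1 (fun u => \prod_(i <- r) f i u)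
    (\sum_(k <- r) \prod_(i <- r) (if i == k then df i else f i t)).
Proof.
move=> ur dfi; elim: r ur => [_|a r IHr /= /andP[ar ur]].
  under eq_fun do rewrite big_nil.
  by rewrite big_nil; exact: is_derive_cst.
under eq_fun do rewrite big_cons.
apply: is_derive_eq (is_deriveM (dfi a) (IHr ur)) _.
rewrite big_cons addrC; congr (_ + _).
  rewrite big_cons eqxx /GRing.scale /= mulrC; congr (_ * _).
  by apply: eq_big_seq => i ir; case: eqP => // ia; rewrite -ia ir in ar.
rewrite /GRing.scale /= mulr_sumr; apply: eq_big_seq => k kr.
by rewrite big_cons; case: eqP => // ak; rewrite ak kr in ar.
Qed.

(** Jacobi's formula. Both sides are the sum over k of the determinants of [B k], that is c(t) with
    row k replaced by that of dc: the trace by expansion along row k, the derivative by the Leibniz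
    rule in the sum over permutations. *)
Lemma is_derive_det n (c : R -> 'M[R]_n) (dc : 'M[R]_n) (t : R) :
  (forall i j, is_derive t 1 (fun u => c u i j) (dc i j)) ->
  is_derive t 1 (fun u => \det (c u)) (\tr (\adj (c t) *m dc)).
Proof.
move=> dcE.
have -> : (fun u => \det (c u)) =
    \sum_(s : {perm 'I_n}) (fun u => (-1) ^+ s * \prod_i c u i (s i)).
  by apply/funext => u; rewrite fct_sumE.
pose B k := \matrix_(i, j) (if i == k then dc i j else c t i j).
have -> : \tr (\adj (c t) *m dc) = \sum_k \det (B k).
  rewrite mxtrace_mulC; apply: eq_bigr => k _.
  rewrite (expand_det_row _ k) mxE; apply: eq_bigr => j _.
  rewrite !mxE eqxx; congr (_ * (_ * \det _)).
  by apply/matrixP => i l; rewrite !mxE eq_sym (negPf (neq_lift _ _)).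
have -> : \sum_k \det (B k) = \sum_(s : {perm 'I_n}) (-1) ^+ s *
    \sum_(k <- index_enum 'I_n) \prod_i (if i == k then dc i (s i) else c t i (s i)).
  rewrite exchange_big /=; apply: eq_bigr => s _; rewrite mulr_sumr.
  apply: eq_bigr => k _; congr (_ * _); apply: eq_bigr => i _; by rewrite mxE.
apply: (big_ind2 (fun F v => is_derive t 1 F v)) => [|F v G w dF dG|s _].
- exact: is_derive_cst.
- exact: is_deriveD.
- apply: (@is_deriveZ _ _ _ (fun u => \prod_i c u i (s i))).
  apply: (is_derive_prod (f := fun i u => c u i (s i)) (df := fun i => dc i (s i))).
  exact: index_enum_uniq.
Qed.

End DetDerivative.

(** * Effect of scaling on the metric, and a reparametrization of the interval *)

Section Riem.
Context {R : realType}.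

Lemma is_derive_mx m n (c : R -> 'M[R]_(m, n)) (M : 'M[R]_(m, n)) (t : R) :
  (forall i j, is_derive t 1 (fun u => c u i j) (M i j)) -> is_derive t 1 c M.
Proof.
move=> cM; have dc : derivable c t 1 by apply/derivable_mxP => i j; have [] := cM i j.
apply: DeriveDef => //; rewrite derive_mx//; apply/matrixP => i j.
by rewrite mxE; have [] := cM i j.
Qed.

(** Lets the speed of a rescaled segment be computed without its scalar factor. *)
Lemma riem_innerZ n (a : R) (P A B : 'M[R]_n) : a != 0 -> P \in unitmx ->
  riem_inner (a *: P) (a *: A) (a *: B) = riem_inner P A B.
Proof.
move=> a0 uP; have uaP : a *: P \in unitmx by rewrite unitmxZ ?unitfE.
rewrite /riem_inner invmxZ//.
by rewrite -!(scalemxAl, scalemxAr) !scalerA mulfV// mul1r mulVf// scale1r.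
Qed.

(* The multiple of P added to s E is the one that makes tr(P^-1 A) = 0, as for
   the velocity of a path of determinant 1. *)
Lemma riem_inner_normalized n (P E : 'M[R]_n.+1) (s : R) : P \in unitmx ->
  let A := (- (n.+1%:R^-1 * \tr (invmx P *m E) * s)) *: P + s *: E in
  riem_inner P A A <= s ^+ 2 * riem_inner P E E.
Proof.
move=> uP; pose m := \tr (invmx P *m E).
pose b := - (n.+1%:R^-1 * m * s).
rewrite /= -/m -/b.
have -> : riem_inner P (b *: P + s *: E) (b *: P + s *: E) =
    b ^+ 2 * n.+1%:R + 2 * b * s * m + s ^+ 2 * riem_inner P E E.
  have riemE A : riem_inner P A A = \tr ((invmx P *m A) *m (invmx P *m A)).
    by rewrite /riem_inner !mulmxA.
  rewrite !riemE; have -> : invmx P *m (b *: P + s *: E) =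
      b%:M + s *: (invmx P *m E).
    by rewrite mulmxDr -!scalemxAr mulVmx// scalemx1.
  rewrite !(mulmxDr, mulmxDl) -!(scalemxAl, scalemxAr) !mul_scalar_mx.
  rewrite mul_mx_scalar !linearD /= !linearZ /= mxtrace_scalar -/m.
  by rewrite -[b *+ _]mulr_natr; ring.
rewrite gerDr.
have -> : b ^+ 2 * n.+1%:R + 2 * b * s * m = - (n.+1%:R^-1 * (m * s) ^+ 2).
  by rewrite /b; field; rewrite ?natr1 ?nat1r pnatr_eq0.
by rewrite oppr_le0 mulr_ge0 ?sqr_ge0// invr_ge0.
Qed.

Lemma invmx_cvg n T (F : set_system T) (FF : Filter F) (f : T -> 'M[R]_n)
    (A : 'M[R]_n) : A \in unitmx -> f t @[t --> F] --> A ->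
  invmx (f t) @[t --> F] --> invmx A.
Proof.
move=> uA fA; have d0 : \det A != 0 by rewrite -unitfE -unitmxE.
have fd : \det (f t) @[t --> F] --> \det A by exact: det_cvg.
have : (\det (f t))^-1 *: \adj (f t) @[t --> F] --> invmx A.
  rewrite /invmx uA; apply: mx_cvg => i j; rewrite mxE.
  under eq_fun do rewrite mxE.
  apply: cvgM; first exact: cvgV.
  by apply: mx_entry_cvg; exact: adj_cvg.
apply: cvg_trans; apply: near_eq_cvg.
(* [invmx] returns its argument when this is singular, so the formula adj / det is used only where
   the determinant is nonzero, which holds eventually. *)
have : \forall t \near F, \det (f t) != 0.
  exact: (cvgr_neq0 _ fd d0).
by apply: filterS => t ft0; rewrite /invmx unitmxE unitfE ft0.
Qed.

(* A reparametrization of [0, 1] which stays in [0, 1] at all real times, as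
   C1_path_in wants paths that are C^1 on the whole line. *)
Definition smooth_step (u : R) : R := sin (pi / 2 * u) ^+ 2.

Definition dsmooth_step (u : R) : R := pi * (sin (pi / 2 * u) * cos (pi / 2 * u)).

Lemma is_derive_smooth_step (t : R) : is_derive t 1 smooth_step (dsmooth_step t).
Proof.
rewrite /smooth_step /dsmooth_step.
apply: is_derive_eq.
rewrite /GRing.scale /=.
by field.
Qed.

Lemma smooth_step_itv u : 0 <= smooth_step u <= 1.
Proof.
rewrite sqr_ge0 /= -(cos2Dsin2 (pi / 2 * u)) lerDr sqr_ge0//.
Qed.

Lemma smooth_step0 : smooth_step 0 = 0.
Proof. by rewrite /smooth_step mulr0 sin0 expr0n. Qed.

Lemma smooth_step1 : smooth_step 1 = 1.
Proof. by rewrite /smooth_step mulr1 sin_pihalf expr1n. Qed.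

Lemma dsmooth_step_cont : continuous dsmooth_step.
Proof.
move=> t; apply: cvgM; first exact: cvg_cst.
have lin : pi / 2 * u @[u --> t] --> (pi / 2 * t : R).
  by apply: cvgM; [exact: cvg_cst|exact: cvg_id].
apply: cvgM.
  by apply: (cvg_comp (fun u : R => pi / 2 * u) sin lin); exact: continuous_sin.
by apply: (cvg_comp (fun u : R => pi / 2 * u) cos lin); exact: continuous_cos.
Qed.

Lemma dsmooth_step_le u : `|dsmooth_step u| <= pi.
Proof.
rewrite normrM (ger0_norm (pi_ge0 R)) ler_piMr ?pi_ge0// normrM.
by apply: mulr_ile1 => //; rewrite ler_norml ?sin_geN1 ?sin_le1 ?cos_geN1 ?cos_le1.
Qed.

End Riem.

(** * The segment between two matrices, rescaled to determinant 1 *)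

Section ShortPath.
Context {R : realType} {n : nat}.
Context (A B : 'M[R]_n.+1).
Let P (s : R) := (1 - s) *: A + s *: B.
Let Q (u : R) := P (smooth_step u).
(** Logarithm of det(Q u)^(-1/(n+1)), the factor that brings a matrix of size n + 1 to determinant
    1. *)
Let logdet (u : R) := - (n.+1%:R^-1 * ln (\det (Q u))).
Let scale (u : R) := expR (logdet u).
(** The derivative of [logdet] by Jacobi's formula; it is also the coefficient of P in
    [riem_inner_normalized] for s = [dsmooth_step u]. *)
Let dlogdet (u : R) :=
  - (n.+1%:R^-1 * \tr (invmx (Q u) *m (B - A)) * dsmooth_step u).
Definition segment_path (u : R) := scale u *: Q u.
Let dpath (u : R) :=
  scale u *: (dlogdet u *: Q u + dsmooth_step u *: (B - A)).

Context (detP : forall s, 0 <= s <= 1 -> 0 < \det (P s)).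

Let detQ u : 0 < \det (Q u).
Proof. exact/detP/smooth_step_itv. Qed.

Let uQ u : Q u \in unitmx.
Proof. by rewrite unitmxE unitfE gt_eqF. Qed.

Let dQ (t : R) i j :
  is_derive t 1 (fun u => Q u i j) (dsmooth_step t * (B - A) i j).
Proof.
have -> : (fun u => Q u i j) = (fun u => A i j + (B i j - A i j) * smooth_step u).
  by apply/funext => u; rewrite !mxE; ring.
have := is_derive_smooth_step t => ds.
apply: is_derive_eq; rewrite /GRing.scale /= !mxE; ring.
Qed.

Let Q_cont (t : R) : Q u @[u --> t] --> Q t.
Proof. by apply: derivable_cvg; apply/derivable_mxP => i j; have [] := dQ t i j. Qed.

Let is_derive_logdet (t : R) : is_derive t 1 logdet (dlogdet t).
Proof.
have dD : is_derive t 1 (fun u => \det (Q u))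
    (\tr (\adj (Q t) *m (dsmooth_step t *: (B - A)))).
  by apply: is_derive_det => i j; rewrite mxE; exact: dQ.
have dL := is_derive1_comp (is_derive1_ln (detQ t)) dD.
have := is_deriveZ (- n.+1%:R^-1) dL.
have -> : (- n.+1%:R^-1 \*: (@ln R \o (fun u => \det (Q u)))) = logdet.
  by apply/funext => u; rewrite /logdet /= -mulNr.
move=> d; apply: is_derive_eq d _.
rewrite -scalemxAr mxtraceZ /dlogdet /invmx uQ -scalemxAl mxtraceZ.
by rewrite {1}/GRing.scale /=; ring.
Qed.

Let is_derive_scale (t : R) : is_derive t 1 scale (scale t * dlogdet t).
Proof. exact: is_derive1_comp. Qed.

Lemma is_derive_segment_path (t : R) : is_derive t 1 segment_path (dpath t).
Proof.
apply: is_derive_mx => i j.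
have -> : (fun u => segment_path u i j) = scale * (fun u => Q u i j).
  by apply/funext => u; rewrite mxE.
apply: is_derive_eq (is_deriveM (is_derive_scale t) (dQ t i j)) _.
by rewrite !mxE /GRing.scale /=; ring.
Qed.

Lemma derive1_segment_path : derive1 segment_path = dpath.
Proof.
by apply/funext => t; rewrite derive1E; have [] := is_derive_segment_path t.
Qed.

Lemma segment_path_C1 S : (forall u, S (segment_path u)) ->
  C1_path_in S segment_path.
Proof.
move=> Sp; split=> //; first by move=> t; have [] := is_derive_segment_path t.
rewrite derive1_segment_path => t.
have scale_cont : scale u @[u --> t] --> scale t.
  by apply: derivable_cvg; have [] := is_derive_scale t.
have tr_cont : \tr (invmx (Q u) *m (B - A)) @[u --> t] --> \tr (invmx (Q t) *m (B - A)).
  apply: mxtrace_cvg; apply: mulmx_cvg; last exact: cvg_cst.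
  apply: invmx_cvg; [exact: uQ|exact: Q_cont].
have dl_cont : dlogdet u @[u --> t] --> dlogdet t.
  apply: cvgN; apply: cvgM; last exact: dsmooth_step_cont.
  by apply: cvgM; first exact: cvg_cst.
apply: cvgZ => //; apply: cvgD; apply: cvgZ => //.
- exact: Q_cont.
- exact: dsmooth_step_cont.
- exact: cvg_cst.
Qed.

Lemma segment_path_det u : \det (segment_path u) = 1.
Proof.
rewrite detZ -expRM_natl /logdet.
rewrite mulrN mulVKf ?pnatr_eq0// expRN lnK ?posrE ?detQ// mulVf// gt_eqF//.
Qed.

Lemma segment_path0 : \det A = 1 -> segment_path 0 = A.
Proof.
move=> dA; rewrite /segment_path /scale /logdet /Q smooth_step0 /P subr0 scale1r.
by rewrite scale0r addr0 dA ln1 mulr0 oppr0 expR0 scale1r.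
Qed.

Lemma segment_path1 : \det B = 1 -> segment_path 1 = B.
Proof.
move=> dB; rewrite /segment_path /scale /logdet /Q smooth_step1 /P subrr scale0r.
by rewrite scale1r add0r dB ln1 mulr0 oppr0 expR0 scale1r.
Qed.

(** The scalar factor cancels in the metric, the correction keeping the determinant at 1 does not
    increase the norm, and the reparametrization contributes at most pi. *)
Lemma speed_segment_path_le (e : R) u : 0 <= e ->
  (forall s, 0 <= s <= 1 -> riem_inner (P s) (B - A) (B - A) <= e ^+ 2) ->
  speed segment_path u <= pi * e.
Proof.
move=> e0 He.
rewrite -[leRHS]ger0_norm ?mulr_ge0 ?pi_ge0// -sqrtr_sqr ler_wsqrtr//.
rewrite derive1_segment_path /dpath /segment_path riem_innerZ ?gt_eqF ?expR_gt0//.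
apply: le_trans (riem_inner_normalized _ _ (uQ u)) _.
rewrite [(pi * e) ^+ 2]exprMn -[dsmooth_step u ^+ 2]real_normK ?num_real//.
apply: le_trans (_ : `|dsmooth_step u| ^+ 2 * e ^+ 2 <= _).
  by rewrite ler_wpM2l ?sqr_ge0//; apply: He; exact: smooth_step_itv.
by rewrite ler_wpM2r ?sqr_ge0// lerXn2r ?nnegrE ?pi_ge0//; exact: dsmooth_step_le.
Qed.

End ShortPath.

(** * Short paths inside the domain, and convergence of Cauchy sequences *)

Section Completeness.
Context {R : realType} {n : nat}.
Implicit Types (X Y Z A B : 'M[R]_n.+1) (c : R -> 'M[R]_n.+1).
Notation mu := (@lebesgue_measure R).

Lemma path_length_le c (e : R) : C1_path_in (@Xspace R n.+1) c ->
  (forall t, speed c t <= e) -> (path_length c <= e%:E)%E.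
Proof.
move=> pc ce.
have i_g : mu.-integrable `[0, 1] (EFin \o speed c).
  apply: continuous_compact_integrable; first exact: segment_compact.
  exact: speed_continuous.
have i_e : mu.-integrable `[0, 1] (EFin \o cst e).
  apply: continuous_compact_integrable; first exact: segment_compact.
  by apply: continuous_subspaceT => t; exact: cvg_cst.
apply: le_trans (le_integral _ i_g i_e _) _ => //.
  by move=> t _; rewrite lee_fin.
rewrite /= integral_cst//= lebesgue_measure_itv /= lte_fin ltr01.
by rewrite oppr0 adde0 mule1.
Qed.

Lemma pos_def_segment A B (s : R) : 0 <= s <= 1 -> pos_def A -> pos_def B ->
  pos_def ((1 - s) *: A + s *: B).
Proof.
move=> /andP[s0 s1] pA pB v v0.
have -> : (v^T *m ((1 - s) *: A + s *: B) *m v) 0 0 =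
    (1 - s) * (v^T *m A *m v) 0 0 + s * (v^T *m B *m v) 0 0.
  by rewrite mulmxDr mulmxDl -!(scalemxAr, scalemxAl) !mxE.
have a0 := pA v v0; have b0 := pB v v0.
have [->|s_neq0] := eqVneq s 0; first by rewrite subr0 mul1r mul0r addr0.
apply: ltr_wpDl; first by rewrite mulr_ge0 ?subr_ge0// ltW.
by rewrite mulr_gt0// lt_neqAle eq_sym s_neq0.
Qed.

(** The inequalities defining the domain are linear and homogeneous in Y, so they pass to convex
    combinations and to positive multiples. *)
Lemma DS_segment_path X Gamma0 A B :
  (forall s, 0 <= s <= 1 -> 0 < \det ((1 - s) *: A + s *: B)) ->
  DS X Gamma0 A -> DS X Gamma0 B ->
  forall u, DS X Gamma0 (segment_path A B u).
Proof.
move=> detP [[sA _ pA] GA] [[sB _ pB] GB] u.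
have s01 := smooth_step_itv u.
split.
  split; [|exact: segment_path_det|].
    have trmxZ (a : R) (C : 'M[R]_n.+1) : (a *: C)^T = a *: C^T by rewrite linearZ.
    have trmxD (C E : 'M[R]_n.+1) : (C + E)^T = C^T + E^T by rewrite linearD.
    by rewrite /Sym /= /segment_path  trmxZ trmxD !trmxZ sA sB.
  move=> v v0; rewrite /segment_path -scalemxAr -scalemxAl mxE mulr_gt0 ?expR_gt0//.
  exact: pos_def_segment.
move=> g Gg; have /andP[s0 s1] := s01.
have lin C (a b k : R) : selberg C (k *: (a *: A + b *: B)) =
    k * (a * selberg C A + b * selberg C B).
  by rewrite /selberg -scalemxAr mxtraceZ mulmxDr mxtraceD -!scalemxAr !mxtraceZ.
rewrite /segment_path !lin ler_wpM2l ?expR_ge0// lerD// ler_wpM2l ?subr_ge0//.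
  exact: GA.
exact: GB.
Qed.

Lemma near_short_path X Gamma0 Y (e : R) : DS X Gamma0 Y -> 0 < e ->
  \forall A \near Y, DS X Gamma0 A -> exists c,
    [/\ C1_path_in (DS X Gamma0) c, c 0 = A, c 1 = Y &
        (path_length c <= e%:E)%E].
Proof.
move=> DY e0; have [[sY dY pY] _] := DY.
have pi0 : 0 < pi :> R := pi_gt0 R.
have uY : Y \in unitmx by rewrite unitmxE dY unitr1.
have det_near : \forall P \near Y, 0 < \det P.
  have dc : \det P @[P --> Y] --> \det Y by apply: (@det_cvg _ _ (nbhs Y) _ _ id); exact: cvg_id.
  by apply: (cvgr_gt _ dc); rewrite dY.
(* The metric is jointly continuous in the base point and the vector, and vanishes at (Y, 0). The
   bound e / pi compensates the factor pi of [speed_segment_path_le]. *)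
have riem_near : \forall z \near (Y, 0 : 'M[R]_n.+1),
    riem_inner z.1 z.2 z.2 < (e / pi) ^+ 2.
  have rc : riem_inner z.1 z.2 z.2 @[z --> (Y, 0 : 'M[R]_n.+1)] --> riem_inner Y 0 0.
    apply: mxtrace_cvg; do ! apply: mulmx_cvg; do ? exact: cvg_snd.
      by apply: invmx_cvg => //; exact: cvg_fst.
    by apply: invmx_cvg => //; exact: cvg_fst.
  apply: (cvgr_lt _ rc); rewrite /riem_inner !mulmx0 linear0.
  by rewrite exprn_gt0// divr_gt0.
have /nbhs_ballP[d1 /= d10 H1] := det_near.
have /nbhs_ballP[d2 /= d20 H2] := riem_near.
near=> A => DA.
have AY1 : `|Y - A| < d1 by near: A; apply: cvgr_dist_lt => //; exact: cvg_id.
have AY2 : `|Y - A| < d2 by near: A; apply: cvgr_dist_lt => //; exact: cvg_id.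
(* The whole segment stays as close to Y as A is, so both neighbourhoods contain what is needed
   along it. *)
have PY s : 0 <= s <= 1 -> `|Y - ((1 - s) *: A + s *: Y)| <= `|Y - A|.
  move=> /andP[s0 s1].
  have -> : Y - ((1 - s) *: A + s *: Y) = (1 - s) *: (Y - A).
    by apply/matrixP => i j; rewrite !mxE; ring.
  by rewrite normrZ ger0_norm ?subr_ge0// ler_piMl// gerBl.
have detP s : 0 <= s <= 1 -> 0 < \det ((1 - s) *: A + s *: Y).
  move=> s01; apply: H1; rewrite -ball_normE /=.
  exact: le_lt_trans (PY s s01) _.
have pathD := DS_segment_path detP DA DY.
exists (segment_path A Y); split.
- exact: segment_path_C1.
- by have [[_ dA _] _] := DA; exact: segment_path0.
- exact: segment_path1.
- apply: path_length_le.
    by apply: segment_path_C1 => // u; have [] := pathD u.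
  move=> u; have -> : e = pi * (e / pi) by rewrite mulrC divfK ?gt_eqF.
  apply: speed_segment_path_le => //; first by rewrite divr_ge0// ltW.
  move=> s s01; apply: ltW.
  apply: (H2 ((1 - s) *: A + s *: Y, Y - A)); split; rewrite -ball_normE /=.
    exact: le_lt_trans (PY s s01) _.
  by rewrite sub0r normrN.
Unshelve. all: by end_near. Qed.

End Completeness.

Theorem glued_space_complete (R : realType) (n : nat) (X : 'M[R]_n.+1)
    (Gamma0 : set 'M[R]_n.+1) (gF : set 'M[R]_n.+1 -> 'M[R]_n.+1) :
  Xspace X -> Gamma0 `<=` @SL R n.+1 ->
  facet_pairing X Gamma0 (DS X Gamma0) gF ->
  complete_for (glued_space (DS X Gamma0) gF) (glued_dist (DS X Gamma0) gF).
Proof.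
move=> XX GSL pair u uM uC; set D := DS X Gamma0.
have [_ dX _] := XX.
have uX : X \in unitmx by rewrite unitmxE dX unitr1.
have DX : D `<=` @Xspace R n.+1 by move=> Y [].
have inv Y Z : facet_equiv D gF Y Z -> selberg X Y = selberg X Z.
  exact: selberg_facet_equiv uX GSL pair.
have /choice[y Hy] : forall k, exists Y, D Y /\
    u k = [set Z | D Z /\ facet_equiv D gF Y Z].
  by move=> k; have [Y DY <-] := uM k; exists Y.
have y_pos k : 0 < selberg X (y k).
  have [/DX[sy _ py] _] := Hy k; have [sX _ pX] := XX; exact: selberg_gt0.
(* A distance below e is witnessed by a chain, whose ends are representatives that may differ from
   [y N] and [y k]. *)
have close (e : R) N k : (glued_dist D gF (u N) (u k) < e%:E)%E ->
    exists Y Z l, [/\ facet_equiv D gF (y N) Y, D Z, facet_equiv D gF (y k) Z,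
      chain D (facet_equiv D gF) Y Z l & (l < e%:E)%E].
  move=> /ereal_inf_lt[l [Y [Z []]]].
  have [_ ->] := Hy N; have [_ ->] := Hy k => -[_ EY] [DZ EZ] ch le.
  by exists Y, Z, l.
have [N HN] := uC 1 ltr01.
(* From N on, the classes are at distance less than 1 from that of [y N], so ln s exceeds its value
   at [y N] by at most 1. *)
pose C := expR (1 + ln (selberg X (y N))).
have yC k : (N <= k)%N -> (D `&` [set Y | selberg X Y <= C]) (y k).
  move=> Nk; have [Dy _] := Hy k; split=> //=.
  have [Y [Z [l [EY DZ EZ ch l1]]]] := close 1 N k (HN N k (leqnn N) Nk).
  have := le_lt_trans (ln_selberg_chain XX DX (fun U V _ _ => @inv U V) ch) l1.
  rewrite -(inv _ _ EY) -(inv _ _ EZ) lte_fin => h.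
  by rewrite -[leLHS]lnK ?posrE// ler_expR -lerBlDr ltW.
have [Y [[DY _] clY]] : D `&` [set Y | selberg X Y <= C] `&` cluster (y @ \oo) !=set0.
  apply: DS_sublevel_compact => //.
  by exists N => // k /= Nk; exact: yC.
exists [set Z | D Z /\ facet_equiv D gF Y Z]; first by exists Y.
move=> e e0; have e2 : 0 < e / 2 by rewrite divr_gt0.
have [N' HN'] := uC _ e2; exists N' => k N'k.
have e4 : 0 < e / 4 by rewrite divr_gt0.
have yN' : (y @ \oo) (y @` [set j | (N' <= j)%N]).
  by exists N' => // j N'j; exists j.
(* Clustering gives a single index j beyond N' with [y j] near Y; the Cauchy property then brings
   every later class within e / 2 of that of [y j]. *)
have [_ [[j /= N'j <-] short]] := clY _ _ yN' (near_short_path DY e4).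
have [c [pc c0 c1 ce]] := short (Hy j).1.
have [Z [W [l [EZ DW EW ch le]]]] := close _ _ _ (HN' k j N'k N'j).
(* W is equivalent to [y j]: jump there, follow the short path to Y, and end with the trivial jump
   that closes every chain. *)
have chWY : chain D (facet_equiv D gF) W Y (path_length c + 0).
  apply: chain_path => //; first by rewrite c0; exact: rst_sym.
  by rewrite c1; apply: chain_jump => //; exact: rst_refl.
have chZY := chain_cat (@facet_equiv_trans R n D gF) ch chWY.
apply: (@le_lt_trans _ _ (l + (path_length c + 0))%E).
  apply: ereal_inf_lbound; exists Z, Y; split=> //.
    have [_ ->] := Hy k; split=> //.
    by case: ch.
  by split=> //; exact: rst_refl.
rewrite adde0 [e in (_ < e%:E)%E]splitr EFinD; apply: lteD => //.
by apply: le_lt_trans ce _; rewrite lte_fin ltr_pM2l// ltf_pV2 ?posrE// ltr_nat.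
Qed.

Unset Implicit Arguments.

Theorem theorem1p2 (R : realType) (X : 'M[R]_3) (Gamma0 : set 'M[R]_3)
    (gF : set 'M[R]_3 -> 'M[R]_3)
    (hX : Xspace X)
    (hfin : finite_set Gamma0)
    (hSL : Gamma0 `<=` SL)
    (hexact : facet_pairing X Gamma0 (DS X Gamma0) gF)
    (htiling : tiling_condition (DS X Gamma0) gF)
    (hvol : finite_volume (DS X Gamma0)) :
  complete_for (glued_space (DS X Gamma0) gF) (glued_dist (DS X Gamma0) gF).
Proof. exact: glued_space_complete. Qed.
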